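(* Let $L=\mathbb{Z}\wr\mathbb{Z}$ be the lamplighter group, equipped with the standard cyclic generators of the two factors of the wreath product. Then $L$ has uncountably many isomorphism types of (marked) square roots.
   Context: $I=[0,1]$ and $\mathrm{Homeo}^+(I)$ is the group of orientation-preserving homeomorphisms of $I$. $\mathbb{Z}\wr\mathbb{Z}\cong\mathbb{Z}\ltimes\bigoplus_{i\in\mathbb{Z}}\mathbb{Z}_i$, where each $\mathbb Z_i$ is a copy of $\mathbb Z$ and the generator of the acting $\mathbb{Z}$ translates the index $\mathbb{Z}_i\mapsto\mathbb{Z}_{i+1}$; its standard generators are a generator of the summand $\mathbb{Z}_0$ and a generator of the acting copy of $\mathbb{Z}$. For a group $K=\langle k_1,\ldots,k_m\rangle$ with a chosen generating tuple, a (marked) square root of $K$ is an $m$-generated subgroup $G=\langle g_1,\ldots,g_m\rangle<\mathrm{Homeo}^+(I)$ such that $K\cong\langle g_1^2,\ldots,g_m^2\rangle$, the isomorphism being taken to send $k_i$ to $g_i^2$. *)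

(* Defs.v *)
From HB Require Import structures.
From mathcomp Require Import all_boot all_order all_algebra finmap.
From mathcomp Require Import all_classical all_reals all_analysis.

Set Implicit Arguments.
Unset Strict Implicit.
Unset Printing Implicit Defensive.

Import Order.TTheory GRing.Theory Num.Theory.
Import numFieldNormedType.Exports.

Local Open Scope classical_set_scope.
Local Open Scope ring_scope.

Definition generated_subgroup (T : groupType) (S : set T) : set T :=
  smallest (fun H : set T => group_closed (mem H)) S.

(* [phi] is only relevant on [G]: its values outside [G] are arbitrary. *)
Definition group_iso_on (T U : groupType) (G : set T) (H : set U)
    (phi : T -> U) : Prop :=
  set_bij G H phi /\ {in G &, {morph phi : x y / (x * y)%g}}.

Definition isomorphic_subgroups (T U : groupType) (G : set T) (H : set U) :=
  exists phi : T -> U, group_iso_on G H phi.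

Definition isomorphism_type (T : groupType) (G : set T) : set (set T) :=
  [set H | isomorphic_subgroups G H].

Section HomeoPlus.
Variable R : realType.

Definition unit_interval : set R := `[0, 1].

(* The inverse is stored as data, but is determined by [homeo_fun]. *)
Record homeo_plus := HomeoPlus {
  homeo_fun :> unit_interval -> unit_interval;
  homeo_inv : unit_interval -> unit_interval;
  homeo_funK : cancel homeo_fun homeo_inv;
  homeo_invK : cancel homeo_inv homeo_fun;
  homeo_fun_continuous : continuous homeo_fun;
  homeo_inv_continuous : continuous homeo_inv;
  homeo_increasing : {homo homeo_fun : x y / \val x < \val y}
}.

Lemma homeo_plusP (f g : homeo_plus) : homeo_fun f =1 homeo_fun g -> f = g.
Proof.
case: f g => [f f' fK f'K fc f'c fi] [g g' gK g'K gc g'c gi] /= /funext efg.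
have ef'g' : f' = g'.
  by apply/funext => x; rewrite -[in LHS](g'K x) -efg fK.
by subst g g'; congr HomeoPlus; exact: Prop_irrelevance.
Qed.

HB.instance Definition _ := gen_eqMixin homeo_plus.
HB.instance Definition _ := gen_choiceMixin homeo_plus.

Definition homeo_one : homeo_plus.
Proof.
exact: (@HomeoPlus idfun idfun (fun=> erefl) (fun=> erefl)
  (fun=> cvg_id) (fun=> cvg_id) (fun x y => id)).
Defined.

Definition homeo_mul (f g : homeo_plus) : homeo_plus.
Proof.
refine (@HomeoPlus (homeo_fun f \o homeo_fun g) (homeo_inv g \o homeo_inv f)
  (can_comp (homeo_funK f) (homeo_funK g))
  (can_comp (homeo_invK g) (homeo_invK f)) _ _ _).
- by move=> x; apply: continuous_comp; exact: homeo_fun_continuous.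
- by move=> x; apply: continuous_comp; exact: homeo_inv_continuous.
- by move=> x y xy; do 2 apply: homeo_increasing.
Defined.

Lemma homeo_inv_increasing (f : homeo_plus) :
  {homo homeo_inv f : x y / \val x < \val y}.
Proof.
move=> x y xy; rewrite ltNge; apply/negP; rewrite le_eqVlt => /orP[/eqP|].
  by move=> /val_inj /(can_inj (homeo_invK f)) e; rewrite e ltxx in xy.
by move=> /(@homeo_increasing f); rewrite !homeo_invK ltNge (ltW xy).
Qed.

Definition homeo_opp (f : homeo_plus) : homeo_plus :=
  HomeoPlus (homeo_invK f) (homeo_funK f) (@homeo_inv_continuous f)
    (@homeo_fun_continuous f) (@homeo_inv_increasing f).

Lemma homeo_mulA : associative homeo_mul.
Proof. by move=> f g h; exact: homeo_plusP. Qed.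

Lemma homeo_mul1 : left_id homeo_one homeo_mul.
Proof. by move=> f; exact: homeo_plusP. Qed.

Lemma homeo_mulr1 : right_id homeo_one homeo_mul.
Proof. by move=> f; exact: homeo_plusP. Qed.

Lemma homeo_mulV : left_inverse homeo_one homeo_opp homeo_mul.
Proof. by move=> f; apply: homeo_plusP => x; exact: homeo_funK. Qed.

Lemma homeo_mulrV : right_inverse homeo_one homeo_opp homeo_mul.
Proof. by move=> f; apply: homeo_plusP => x; exact: homeo_invK. Qed.

HB.instance Definition _ := isGroup.Build homeo_plus
  homeo_mulA homeo_mul1 homeo_mulr1 homeo_mulV homeo_mulrV.

End HomeoPlus.

(* [k] is meant to generate [K]; the existence of [phi] forces it. *)
Definition marked_square_root (K : groupType) (m : nat) (k : 'I_m -> K)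
    (R : realType) (G : set (homeo_plus R)) : Prop :=
  exists g : 'I_m -> homeo_plus R,
    G = generated_subgroup (range g) /\
    exists phi : K -> homeo_plus R,
      group_iso_on [set: K]
        (generated_subgroup (range (fun i => (g i ^+ 2)%g))) phi /\
      forall i, phi (k i) = (g i ^+ 2)%g.

(* An element [(n, f)] stands for [f] in the base group times the [n]-th power
   of the generator of the acting copy of Z. *)
Definition lamplighter : Type := int * {fsfun int -> int with 0}.

HB.instance Definition _ := Choice.on lamplighter.

Definition lamp_one : lamplighter := (0, [fsfun with 0]).

(* In the semidirect product the integer [n] acts on a finitely supported
   [f] by translation of indices: [(n . f) i = f (i - n)]. *)
Definition lamp_mul (u v : lamplighter) : lamplighter :=
  (u.1 + v.1,
   [fsfun i in (finsupp u.2 `|` [fset (j + u.1)%R | j in finsupp v.2])%fset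
     => u.2 i + v.2 (i - u.1) | 0]).

Definition lamp_inv (u : lamplighter) : lamplighter :=
  (- u.1,
   [fsfun i in [fset (j - u.1)%R | j in finsupp u.2]%fset
     => - u.2 (i + u.1) | 0]).

Lemma lamp_mulE (u v : lamplighter) i :
  (lamp_mul u v).2 i = u.2 i + v.2 (i - u.1).
Proof.
rewrite fsfunE; case: ifPn => //; rewrite in_fsetU negb_or => /andP[iu iv].
rewrite (fsfun_dflt iu) add0r fsfun_dflt //; apply: contra iv => iv.
by apply/imfsetP; exists (i - u.1) => //; rewrite subrK.
Qed.

Lemma lamp_invE (u : lamplighter) i : (lamp_inv u).2 i = - u.2 (i + u.1).
Proof.
rewrite fsfunE; case: ifPn => // iu.
rewrite fsfun_dflt ?oppr0 //; apply: contra iu => iu.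
by apply/imfsetP; exists (i + u.1) => //; rewrite addrK.
Qed.

Lemma lampP (u v : lamplighter) : u.1 = v.1 -> u.2 =1 v.2 -> u = v.
Proof. by case: u v => [m f] [n g] /= -> /fsfunP ->. Qed.

Lemma lamp_mulA : associative lamp_mul.
Proof.
move=> u v w; apply: lampP => [|i]; first exact: addrA.
by rewrite !lamp_mulE /= opprD !addrA.
Qed.

Lemma lamp_mul1 : left_id lamp_one lamp_mul.
Proof.
move=> u; apply: lampP => [|i]; first exact: add0r.
by rewrite lamp_mulE fsfunE add0r subr0.
Qed.

Lemma lamp_mulr1 : right_id lamp_one lamp_mul.
Proof.
move=> u; apply: lampP => [|i]; first exact: addr0.
by rewrite lamp_mulE fsfunE addr0.
Qed.

Lemma lamp_mulV : left_inverse lamp_one lamp_inv lamp_mul.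
Proof.
move=> u; apply: lampP => [|i]; first exact: addNr.
by rewrite lamp_mulE lamp_invE fsfunE opprK addNr.
Qed.

Lemma lamp_mulrV : right_inverse lamp_one lamp_inv lamp_mul.
Proof.
move=> u; apply: lampP => [|i]; first exact: addrN.
by rewrite lamp_mulE lamp_invE fsfunE subrK addrN.
Qed.

HB.instance Definition _ := isGroup.Build lamplighter
  lamp_mulA lamp_mul1 lamp_mulr1 lamp_mulV lamp_mulrV.

Definition lamp_base_gen : lamplighter :=
  (0, [fsfun i in [fset 0]%fset => 1 | 0]).

Definition lamp_acting_gen : lamplighter := (1, [fsfun with 0]).

Definition lamp_gens (i : 'I_2) : lamplighter :=
  if i == 0 then lamp_base_gen else lamp_acting_gen.

Lemma lamp_gens_generate : generated_subgroup (range lamp_gens) = [set: lamplighter].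
Proof.
rewrite -subTset => u _ H [gH /= sH].
have H1 : 1%g \in H by case: gH.
have HM x y : x \in H -> y \in H -> (x * y)%g \in H.
  by exact: group_closedM.
have HV x : x \in H -> (x^-1)%g \in H.
  by exact: group_closedV.
have Ht : lamp_acting_gen \in H.
  by apply/mem_set/sH; exists (lift ord0 ord0).
have Ha : lamp_base_gen \in H by apply/mem_set/sH; exists ord0.
have Htn (n : nat) : ((n%:Z, [fsfun with 0]) : lamplighter) \in H.
  elim: n => [//|n IHn].
  suff -> : ((n.+1%:Z, [fsfun with 0]) : lamplighter)
      = lamp_mul lamp_acting_gen (n%:Z, [fsfun with 0]) by exact: HM.
  apply: lampP => [|i]; first by rewrite /= -add1n PoszD.
  by rewrite lamp_mulE /= !fsfunE addr0.
have HtN (u' : lamplighter) : u'.2 =1 (fun=> 0) -> (lamp_inv u').2 =1 (fun=> 0).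
  by move=> u0 i; rewrite lamp_invE u0 oppr0.
have Htz (n : int) : ((n, [fsfun with 0]) : lamplighter) \in H.
  case: n => n; first exact: Htn.
  suff -> : ((Negz n, [fsfun with 0]) : lamplighter)
      = lamp_inv (n.+1%:Z, [fsfun with 0]) by apply: HV; exact: Htn.
  apply: lampP => [|i]; first by rewrite /= NegzE.
  by rewrite HtN ?fsfunE // => j; rewrite fsfunE.
pose D k c : lamplighter := (0, [fsfun i in [fset k]%fset => c | 0]).
have DE k c i : (D k c).2 i = if i == k then c else 0.
  by rewrite /D /= fsfunE in_fset1.
have D1 k : D k 1 \in H.
  suff -> : D k 1 = lamp_mul (k, [fsfun with 0])
      (lamp_mul lamp_base_gen (- k, [fsfun with 0])).
    by apply: (HM _ _ (Htz k)); exact: (HM _ _ Ha (Htz (- k))).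
  apply: lampP => [|i]; first by rewrite /= add0r subrr.
  by rewrite !lamp_mulE DE /= !fsfunE in_fset1 add0r addr0 subr_eq0.
have Dn k (n : nat) : D k n%:Z \in H.
  elim: n => [|n IHn].
    suff -> : D k 0 = lamp_one by [].
    by apply: lampP => // i; rewrite DE fsfunE; case: ifP.
  suff -> : D k n.+1%:Z = lamp_mul (D k 1) (D k n%:Z) by exact: HM.
  apply: lampP => // i.
  by rewrite lamp_mulE !DE subr0; case: ifP => // _; rewrite -add1n PoszD.
have Dz k c : D k c \in H.
  case: c => n; first exact: Dn.
  suff -> : D k (Negz n) = lamp_inv (D k n.+1%:Z) by exact/HV/Dn.
  apply: lampP => // i.
  by rewrite lamp_invE !DE addr0 NegzE; case: ifP => // _; rewrite oppr0.
have base (s : seq int) (f : {fsfun int -> int with 0}) :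
    {subset finsupp f <= s} -> ((0, f) : lamplighter) \in H.
  elim: s f => [|k s IHs] f sf.
    suff -> : ((0, f) : lamplighter) = lamp_one by [].
    apply: lampP => // i; rewrite fsfunE fsfun_dflt //.
    by apply/negP => /sf.
  pose g := (lamp_mul (lamp_inv (D k (f k))) (0, f)).2.
  have gE i : g i = if i == k then 0 else f i.
    rewrite lamp_mulE lamp_invE DE !addr0 [(0, f).2]/=.
    by case: eqP => [->|_]; rewrite ?addNr // oppr0 add0r.
  suff -> : ((0, f) : lamplighter) = lamp_mul (D k (f k)) (0, g).
    apply: (HM _ _ (Dz _ _)); apply: IHs => i.
    rewrite mem_finsupp gE; case: (eqVneq i k) => [_|nik nz]; first by rewrite eqxx.
    have : i \in k :: s by apply: sf; rewrite mem_finsupp.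
    by rewrite in_cons (negPf nik).
  apply: lampP => // i; rewrite lamp_mulE DE (_ : (D _ _).1 = 0) // subr0 (_ : (0, g).2 = g) // gE.
  by case: eqP => [->|_]; rewrite ?addr0 ?add0r.
apply: set_mem.
suff -> : u = lamp_mul (0, u.2) (u.1, [fsfun with 0]).
  by apply: (HM _ _ (base (finsupp u.2) _ _) (Htz _)).
apply: lampP => [|i]; first by rewrite /= add0r.
by rewrite lamp_mulE /= fsfunE addr0.
Qed.

(* Main.v *)
(* Identify the interior of [0,1] with the real line, and let b be the unit
   translation.  For a set S of naturals, let a_S act on each cell [k,k+1] by a
   copy of a homeomorphism r_k of [0,1], where r_0 = u, r_(2n+1) = v for n in S,
   all other r_k are trivial, and u and v do not commute.  Conjugates of a_S by
   even powers of b only bring together cells of the same parity, where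
   everything commutes, so a_S^2 and b^2 generate a copy of Z wr Z.  On the other
   hand a_S commutes with its conjugate by b^(2n+1) iff n is not in S.  Hence the
   images of a_S and b under an isomorphism onto a group H determine S; since a
   finitely generated H has only countably many pairs of elements, each
   isomorphism type is attained for countably many S only. *)
Require Import Defs.
From mathcomp Require Import all_boot all_order all_algebra finmap.
From mathcomp Require Import lra ring zify.
From mathcomp Require Import all_classical all_reals all_analysis.

Set Implicit Arguments.
Unset Strict Implicit.
Unset Printing Implicit Defensive.

Import Order.TTheory GRing.Theory Num.Theory.
Import numFieldNormedType.Exports.

Local Open Scope classical_set_scope.
Local Open Scope ring_scope.

(** * Homeomorphisms of the interval built from maps of the line *)

Section UnitInterval.
Variable R : realType.
Local Notation I := (@unit_interval R).
Implicit Types f g : I -> I.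

Lemma unit_interval_itv (x : I) : 0 <= val x <= 1.
Proof. by have /set_mem := valP x; rewrite /unit_interval /= in_itv. Qed.

Lemma mem_unit_interval (x : R) : 0 <= x <= 1 -> x \in I.
Proof. by move=> x01; apply/mem_set; rewrite /unit_interval /= in_itv. Qed.

Definition unit_point (x : R) (x01 : 0 <= x <= 1) : I :=
  exist _ x (mem_unit_interval x01).

Lemma increasing_le f : {homo f : x y / val x < val y} ->
  {homo f : x y / val x <= val y}.
Proof.
by move=> fi x y; rewrite le_eqVlt => /orP[/eqP /val_inj -> //|/fi /ltW].
Qed.

Lemma increasing_can f g : cancel g f ->
  {homo f : x y / val x < val y} -> {homo g : x y / val x < val y}.
Proof.
move=> gK fi x y xy; rewrite ltNge; apply/negP => /(increasing_le fi).
by rewrite !gK leNgt xy.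
Qed.

Lemma increasing_fix0 f g : cancel g f -> {homo f : x y / val x < val y} ->
  forall x, val x = 0 -> val (f x) = 0.
Proof.
move=> gK fi x x0; apply/le_anti; case/andP: (unit_interval_itv (f x)) => -> _.
rewrite andbT -[leRHS]x0 -[x in leRHS]gK; apply: (increasing_le fi).
by rewrite x0; case/andP: (unit_interval_itv (g x)).
Qed.

Lemma increasing_fix1 f g : cancel g f -> {homo f : x y / val x < val y} ->
  forall x, val x = 1 -> val (f x) = 1.
Proof.
move=> gK fi x x1; apply/le_anti; case/andP: (unit_interval_itv (f x)) => _ ->.
rewrite /= -[leLHS]x1 -[x in leLHS]gK; apply: (increasing_le fi).
by rewrite x1; case/andP: (unit_interval_itv (g x)).
Qed.

(** An increasing bijection leaves no gap in its image, hence is continuous; homeomorphisms can thus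
    be built from an inverse and monotonicity alone. [F] extends [f] by 0 to the whole of [R]. *)
Lemma increasing_continuous f g : cancel f g -> cancel g f ->
  {homo f : x y / val x < val y} -> continuous f.
Proof.
move=> fK gK fi; have f0 := increasing_fix0 gK fi; have f1 := increasing_fix1 gK fi.
pose F t := if insub t is Some x then val (f x) else 0.
have FE x : F (val x) = val (f x) by rewrite /F valK.
have FE' t (t01 : 0 <= t <= 1) : F t = val (f (unit_point t01)) by rewrite -FE.
have h00 : 0 <= (0 : R) <= 1 by rewrite lexx ler01.
have h11 : 0 <= (1 : R) <= 1 by rewrite lexx ler01.
have F0 : F 0 = 0 by rewrite FE' f0.
have F1 : F 1 = 1 by rewrite FE' f1.
apply: continuous_comp_initial.
have -> : set_val \o f = sigL I F by apply/funext => x; exact/esym/FE.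
apply/subspace_sigL_continuousP; apply: segment_inc_surj_continuous.
  move=> s t; rewrite !in_itv /= => s01 t01; rewrite !FE'.
  have := increasing_le fi (x := unit_point s01) (y := unit_point t01).
  have := increasing_le (increasing_can gK fi) (x := f (unit_point s01)) (y := f (unit_point t01)).
  by rewrite !fK /= => h1 h2; apply/idP/idP.
rewrite F0 F1 => t /=; rewrite in_itv /= => t01.
exists (val (g (unit_point t01))); last by rewrite FE gK.
by rewrite /= in_itv /= unit_interval_itv.
Qed.

Definition increasing_homeo f g (fK : cancel f g) (gK : cancel g f)
    (fi : {homo f : x y / val x < val y}) : homeo_plus R :=
  HomeoPlus fK gK (increasing_continuous fK gK fi)
    (increasing_continuous gK fK (increasing_can gK fi)) fi.

Lemma ereal_point_itv (e : \bar R) : 0 <= (1 + contract e) / 2 <= 1.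
Proof. have := contract_le1 e; rewrite ler_norml => /andP[? ?]; lra. Qed.

(** [contract] maps the extended line onto [-1,1]; after rescaling, the two infinities become the
    endpoints 0 and 1. *)
Definition ereal_point (e : \bar R) : I := unit_point (ereal_point_itv e).

Definition ereal_coord (x : I) : \bar R := expand (2 * val x - 1).

Lemma ereal_pointK : cancel ereal_point ereal_coord.
Proof.
move=> e; rewrite /ereal_coord /= -[RHS]contractK; congr expand.
by rewrite mulrC divfK ?pnatr_eq0 // addrC addKr.
Qed.

Lemma ereal_coordK : cancel ereal_coord ereal_point.
Proof.
move=> x; apply: val_inj; rewrite /= /ereal_coord expandK.
  by rewrite addrC subrK mulrC mulKf ?pnatr_eq0.
by rewrite inE ler_norml; case/andP: (unit_interval_itv x) => ? ?; lra.
Qed.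

Lemma ereal_point_lt : {mono ereal_point : e e' / (e < e')%E >-> val e < val e'}.
Proof. by move=> e e' /=; rewrite ltr_pM2r ?invr_gt0 ?ltr0n // ltrD2l lt_contract. Qed.

Definition line_point (y : R) : I := ereal_point y%:E.

Lemma line_point_inj : injective line_point.
Proof. by move=> y z /(can_inj ereal_pointK) []. Qed.

Section LineHomeo.
Variables F G : R -> R.
Hypotheses (FK : cancel F G) (GK : cancel G F) (Fi : {homo F : x y / x < y}).

(** A map of the line is extended by fixing both infinities, then transported to the interval. *)
Let Phi (H : R -> R) := ereal_point \o er_map H \o ereal_coord.

Let PhiK (H K : R -> R) : cancel H K -> cancel (Phi H) (Phi K).
Proof.
move=> HK x; rewrite /Phi /= ereal_pointK -[RHS]ereal_coordK; congr ereal_point.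
by case: (ereal_coord x) => //= r; rewrite HK.
Qed.

Let Phi_increasing : {homo Phi F : x y / val x < val y}.
Proof.
move=> x y xy.
have : (ereal_coord x < ereal_coord y)%E by rewrite -ereal_point_lt !ereal_coordK.
have -> z : Phi F z = ereal_point (er_map F (ereal_coord z)) by [].
rewrite ereal_point_lt.
case: (ereal_coord x) (ereal_coord y) => [r||] [s||] //;
  rewrite ?lte_fin ?ltry ?ltNyr //.
exact: Fi.
Qed.

Definition line_homeo : homeo_plus R :=
  increasing_homeo (PhiK FK) (PhiK GK) Phi_increasing.

Lemma line_homeoE y : line_homeo (line_point y) = line_point (F y).
Proof. by rewrite /= /Phi /= ereal_pointK. Qed.

End LineHomeo.

(** Every interior point is a line point, and any increasing bijection fixes both endpoints. *)
Lemma homeo_plus_line_eq (f g : homeo_plus R) :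
  (forall y, f (line_point y) = g (line_point y)) -> f = g.
Proof.
move=> fg; apply: homeo_plusP => x; rewrite -[x]ereal_coordK.
case: (ereal_coord x) => [y||]; first exact: fg.
  apply: val_inj; rewrite !(increasing_fix1 (homeo_invK _)) //=;
    by [exact: homeo_increasing | rewrite divff ?pnatr_eq0].
apply: val_inj; rewrite !(increasing_fix0 (homeo_invK _)) //=;
  by [exact: homeo_increasing | rewrite subrr mul0r].
Qed.

End UnitInterval.

(** * Homeomorphisms acting cell by cell *)

(* Each cell [k, k+1] of the line is itself identified with the unit interval, so
   the maps acting on cells are again elements of [homeo_plus R]. *)
Section Cells.
Variable R : realType.
Implicit Types (f g : int -> homeo_plus R) (y : R).
Local Notation floor := Num.floor.

Lemma frac_itv y : 0 <= y - (floor y)%:~R <= 1.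
Proof. by have := floor_itv y; rewrite intrD => /andP[? ?]; lra. Qed.

Definition frac_point y : @unit_interval R := unit_point (frac_itv y).

Definition cell_map f y := (floor y)%:~R + val (f (floor y) (frac_point y)).

Lemma homeo_plus_lt1 (f : homeo_plus R) x : val x < 1 -> val (f x) < 1.
Proof.
have h11 : 0 <= (1 : R) <= 1 by rewrite ler01 lexx.
move=> x1; have /(@homeo_increasing _ f) : val x < val (unit_point h11) by [].
by move/lt_le_trans; apply; case/andP: (unit_interval_itv (f (unit_point h11))).
Qed.

Lemma frac_point_lt1 y : val (frac_point y) < 1.
Proof. by have := floor_itv y; rewrite /= intrD => /andP[? ?]; lra. Qed.

Lemma floor_cell_map f y : floor (cell_map f y) = floor y.
Proof.
apply: floor_def; rewrite /cell_map intrD lerDl ltrD2l.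
rewrite homeo_plus_lt1 ?frac_point_lt1 // andbT.
by case/andP: (unit_interval_itv (f (floor y) (frac_point y))).
Qed.

Lemma frac_cell_map f y : frac_point (cell_map f y) = f (floor y) (frac_point y).
Proof. by apply: val_inj; rewrite /= floor_cell_map [in LHS]/cell_map addrC addKr. Qed.

Lemma cell_map_comp f g y :
  cell_map f (cell_map g y) = cell_map (fun k => f k * g k)%g y.
Proof. by rewrite {1}/cell_map frac_cell_map floor_cell_map. Qed.

Lemma cell_map1 y : cell_map (fun=> 1%g) y = y.
Proof. by rewrite /cell_map /= addrC subrK. Qed.

Lemma cell_mapK f : cancel (cell_map f) (cell_map (fun k => (f k)^-1)%g).
Proof.
move=> y; rewrite cell_map_comp -[RHS]cell_map1; congr (cell_map _ y).
by apply/funext => k; rewrite mulVg.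
Qed.

Lemma cell_mapVK f : cancel (cell_map (fun k => (f k)^-1)%g) (cell_map f).
Proof.
move=> y; rewrite cell_map_comp -[RHS]cell_map1; congr (cell_map _ y).
by apply/funext => k; rewrite mulgV.
Qed.

Lemma cell_map_increasing f : {homo cell_map f : y z / y < z}.
Proof.
move=> y z yz; have := le_floor (ltW yz); rewrite le_eqVlt => /orP[/eqP e|lt_yz].
  rewrite /cell_map e ltrD2l; apply: homeo_increasing.
  by rewrite /= e ltrD2r.
(* In different cells the images are separated by the integer [floor z]. *)
apply: (@lt_le_trans _ _ (floor z)%:~R).
  apply: (@lt_le_trans _ _ (floor y + 1)%:~R).
    by rewrite intrD ltrD2l homeo_plus_lt1 ?frac_point_lt1.
  by rewrite ler_int lezD1.
by rewrite lerDl; case/andP: (unit_interval_itv (f (floor z) (frac_point z))).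
Qed.

Definition cells f : homeo_plus R :=
  line_homeo (@cell_mapK f) (@cell_mapVK f) (@cell_map_increasing f).

Lemma cellsE f y : cells f (line_point y) = line_point (cell_map f y).
Proof. exact: line_homeoE. Qed.

Lemma cellsM f g : (cells f * cells g)%g = cells (fun k => f k * g k)%g.
Proof.
apply: homeo_plus_line_eq => y; rewrite cellsE -cell_map_comp.
by rewrite -!cellsE.
Qed.

Lemma cells_inj f g : cells f = cells g -> f =1 g.
Proof.
move=> fg k; apply: homeo_plus_line_eq => y.
(* [z] lies in cell [k] with local coordinate [line_point y]; as [y] is finite this coordinate is
   below 1, so the floor is exactly [k]. *)
pose z : R := k%:~R + val (line_point y).
have y01 : 0 <= val (line_point y) < 1.
  have := contract_lt1 y; rewrite ltr_norml /= => /andP[? ?]; lra.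
have fz : floor z = k by apply: floor_def; rewrite intrD lerDl ltrD2l.
have zE : frac_point z = line_point y.
  by apply: val_inj; rewrite /= fz /z addrC addKr.
have := cellsE f z; rewrite fg cellsE => /line_point_inj.
by rewrite /cell_map fz zE => /addrI /val_inj.
Qed.

End Cells.

(** * Translations and dilations of the line *)

Section TranslationsDilations.
Variable R : realType.

(** Used at two scales: on the whole line as the powers of b, and inside a single cell as a local
    map. *)
Definition translation (t : R) : homeo_plus R.
Proof.
refine (@line_homeo R (+%R^~ t) (+%R^~ (- t)) (addrK t) _ _).
- exact: subrK.
- by move=> x y; rewrite ltrD2r.
Defined.

Lemma translationE t y : translation t (line_point y) = line_point (y + t).
Proof. exact: line_homeoE. Qed.

Lemma translationM s t : (translation s * translation t)%g = translation (s + t).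
Proof.
apply: homeo_plus_line_eq => y.
by rewrite translationE addrA addrAC -!translationE.
Qed.

Lemma translation0 : translation 0 = 1%g.
Proof. by apply: homeo_plus_line_eq => y; rewrite translationE addr0. Qed.

Lemma translationX t n : (translation t ^+ n)%g = translation (t *+ n).
Proof.
by elim: n => [|n IHn]; rewrite ?translation0 // expgS IHn translationM mulrS.
Qed.

Lemma translation_inj : injective translation.
Proof.
move=> s t st; have := translationE s 0; rewrite st translationE => /line_point_inj.
by rewrite !add0r.
Qed.

Lemma exp2z_gt0 (m : int) : 0 < 2 ^ m :> R.
Proof. exact: exprz_gt0. Qed.

Definition dilation (m : int) : homeo_plus R.
Proof.
refine (@line_homeo R ( *%R (2 ^ m)) ( *%R (2 ^ m)^-1) _ _ _).
- exact: mulKf (lt0r_neq0 (exp2z_gt0 m)).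
- exact: mulVKf (lt0r_neq0 (exp2z_gt0 m)).
- by move=> x y; rewrite ltr_pM2l ?exp2z_gt0.
Defined.

Lemma dilationE m y : dilation m (line_point y) = line_point (2 ^ m * y).
Proof. exact: line_homeoE. Qed.

Lemma dilationM m n : (dilation m * dilation n)%g = dilation (m + n).
Proof.
apply: homeo_plus_line_eq => y.
by rewrite dilationE expfzDr ?pnatr_eq0 // -mulrA -!dilationE.
Qed.

Lemma dilation0 : dilation 0 = 1%g.
Proof. by apply: homeo_plus_line_eq => y; rewrite dilationE expr0z mul1r. Qed.

(** The two composites send 0 to 1 and to 2. *)
Lemma translation_dilation_neq : (translation 1 * dilation 1 <> dilation 1 * translation 1)%g.
Proof.
move=> e; have : translation 1 (dilation 1 (line_point 0)) = dilation 1 (translation 1 (line_point 0)).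
  by have := congr1 (fun f : homeo_plus R => f (line_point 0)) e.
rewrite !(translationE, dilationE) => /line_point_inj; rewrite expr1z; lra.
Qed.

(** Adding an integer shifts the floor and keeps the fractional part, so conjugation only reindexes
    the cells. *)
Lemma translation_cells (n : int) (f : int -> homeo_plus R) :
  (translation n%:~R * cells f)%g = (cells (fun k => f (k - n)) * translation n%:~R)%g.
Proof.
apply: homeo_plus_line_eq => y.
transitivity (translation n%:~R (cells f (line_point y))) => //.
transitivity (cells (fun k => f (k - n)) (translation n%:~R (line_point y))) => //.
rewrite !(translationE, cellsE); congr line_point.
have fl : Num.floor (y + n%:~R) = Num.floor y + n.
  by rewrite floorDrz ?intrKfloor // intr_int.
have fr : frac_point (y + n%:~R) = frac_point y.
  by apply: val_inj; rewrite /= fl intrD; ring.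
by rewrite /cell_map fr fl addrK intrD addrAC.
Qed.

(** Cell maps preserve floors, so the floor of the image of 0 determines the translation part. *)
Lemma cells_translation_inj (m n : int) (f g : int -> homeo_plus R) :
  (cells f * translation m%:~R = cells g * translation n%:~R)%g -> m = n /\ f =1 g.
Proof.
move=> e.
have : cells f (translation m%:~R (line_point 0)) = cells g (translation n%:~R (line_point 0)).
  by have := congr1 (fun f : homeo_plus R => f (line_point 0)) e.
rewrite !translationE !cellsE !add0r => /line_point_inj /(congr1 Num.floor).
rewrite !floor_cell_map !intrKfloor => mn; split=> //.
by apply: cells_inj; move: e; rewrite mn => /mulIg.
Qed.

End TranslationsDilations.

(** * Generated subgroups and isomorphisms between them *)

Section GroupFacts.
Implicit Types T U : groupType.

Lemma generated_subgroup_closed T (S : set T) :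
  group_closed (mem (generated_subgroup S)).
Proof.
split=> [|x y /set_mem Gx /set_mem Gy]; apply/mem_set => H [gH sH].
  by apply: set_mem; case: gH.
have gxy := (Gx _ (conj gH sH), Gy _ (conj gH sH)).
by apply: set_mem; case: gH => _; apply; apply/mem_set; [exact: gxy.1|exact: gxy.2].
Qed.

Lemma generated_subgroup_min T (S H : set T) : group_closed (mem H) ->
  S `<=` H -> generated_subgroup S `<=` H.
Proof. by move=> gH sH; exact: smallest_sub. Qed.

Lemma sub_generated_subgroup T (S : set T) : S `<=` generated_subgroup S.
Proof. exact: sub_gen_smallest. Qed.

Lemma countable_generated_subgroup T (I : countType) (g : I -> T) :
  countable (generated_subgroup (range g)).
Proof.
(* Elements are coded by words; the boolean tells a generator from its inverse. *)
pose letter (u : bool * I) := if u.1 then g u.2 else ((g u.2)^-1)%g.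
pose eval (w : seq (bool * I)) := foldr (fun u x => letter u * x)%g 1%g w.
pose inv (w : seq (bool * I)) := rev [seq (~~ u.1, u.2) | u <- w].
have eval_cat v w : eval (v ++ w) = (eval v * eval w)%g.
  by elim: v => [|u v IHv] /=; rewrite ?mul1g // IHv mulgA.
have eval_inv w : eval (inv w) = ((eval w)^-1)%g.
  elim: w => [|[[] i] w IHw]; first by rewrite /= invg1.
    by rewrite /inv /= rev_cons -cats1 eval_cat [eval (rev _)]IHw /= invgM mulg1.
  by rewrite /inv /= rev_cons -cats1 eval_cat [eval (rev _)]IHw /= invgM mulg1 invgK.
have sub : generated_subgroup (range g) `<=` range eval.
  apply: generated_subgroup_min => [|_ [i _ <-]].
    split=> [|x y /set_mem[v _ <-] /set_mem[w _ <-]]; apply/mem_set.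
      by exists [::].
    by exists (v ++ inv w); rewrite // eval_cat eval_inv.
  by exists [:: (true, i)]; rewrite //= mulg1.
apply: sub_countable (subset_card_le sub) _.
by apply: sub_countable (card_image_le _ _) _; exact: countableP.
Qed.

(** The range is a subgroup containing the images of [S]; conversely, the preimage of the subgroup
    they generate is a subgroup containing [S], hence everything. *)
Lemma range_hom_generated T U (phi : T -> U) (S : set T) :
  {morph phi : x y / (x * y)%g} -> generated_subgroup S = [set: T] ->
  range phi = generated_subgroup (phi @` S).
Proof.
move=> phiM genS.
have phi1 : phi 1%g = 1%g by apply: (mulgI (phi 1%g)); rewrite -phiM !mulg1.
have phiV x : phi (x^-1)%g = ((phi x)^-1)%g.
  by symmetry; apply: mulg1_eq; rewrite -phiM mulgV.
apply/seteqP; split=> [_ [x _ <-]|]; last first.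
  apply: generated_subgroup_min => [|_ [x _ <-]]; last by exists x.
  split=> [|_ _ /set_mem[x _ <-] /set_mem[y _ <-]]; apply/mem_set.
    by exists 1%g.
  by exists (x / y)%g; rewrite // phiM phiV.
have [G1 GB] := generated_subgroup_closed (phi @` S).
have : [set: T] x by []. rewrite -genS.
suff : generated_subgroup S `<=` phi @^-1` generated_subgroup (phi @` S) by exact.
apply: generated_subgroup_min => [|y Sy]; last exact: (sub_generated_subgroup (imageP phi Sy)).
split=> [|y z /set_mem Gy /set_mem Gz]; apply/mem_set.
  by rewrite /preimage /= phi1; exact: set_mem.
by rewrite /preimage /= phiM phiV; apply/set_mem/GB; exact/mem_set.
Qed.

Lemma injective_hom_iso T U (phi : T -> U) : {morph phi : x y / (x * y)%g} ->
  injective phi -> group_iso_on [set: T] (range phi) phi.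
Proof.
move=> phiM phiI; split; last by move=> x y _ _; exact: phiM.
split=> [x _|x y _ _ /phiI //|_ [x _ <-]]; by exists x.
Qed.

(** The isomorphism-invariant relation from which the set of naturals is recovered. *)
Definition commutes_with_conj T n (x y : T) :=
  commute x (y ^+ n * x * (y ^+ n)^-1)%g.

Lemma iso_commutes_with_conj T U (G : set T) (H : set U) (phi : T -> U) n x y :
  group_closed (mem G) -> group_iso_on G H phi -> G x -> G y ->
  commutes_with_conj n (phi x) (phi y) <-> commutes_with_conj n x y.
Proof.
move=> gG [[_ phiI _] phiM] /mem_set Gx /mem_set Gy.
have G1 : 1%g \in G by case: gG.
have GM a b : a \in G -> b \in G -> (a * b)%g \in G by exact: group_closedM.
have GV a : a \in G -> (a^-1)%g \in G by exact: group_closedV.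
have phi1 : phi 1%g = 1%g by apply: (mulgI (phi 1%g)); rewrite -phiM // !mulg1.
have GX : (y ^+ n)%g \in G.
  by elim: n => [|m IHm]; rewrite ?expg0 ?expgS //; exact: GM.
have phiX : phi (y ^+ n)%g = (phi y ^+ n)%g.
  (* Membership is carried through the induction because [phi] is known to be multiplicative on [G]
     only. *)
  have : (y ^+ n)%g \in G /\ phi (y ^+ n)%g = (phi y ^+ n)%g.
    elim: n {GX} => [|m [IHm e]]; first by rewrite !expg0.
    by rewrite !expgS; split; [exact: GM|rewrite phiM // e].
  by case.
have phiV z : z \in G -> phi (z^-1)%g = ((phi z)^-1)%g.
  by move=> Gz; symmetry; apply: mulg1_eq; rewrite -phiM ?mulgV //; exact: GV.
have GVX : ((y ^+ n)^-1)%g \in G by exact: GV.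
have GXx : (y ^+ n * x)%g \in G by exact: GM.
have Gc : (y ^+ n * x * (y ^+ n)^-1)%g \in G by exact: GM.
rewrite /commutes_with_conj /commute -phiX -phiV // -!phiM //.
by split=> [e|-> //]; apply: phiI e; exact: GM.
Qed.

End GroupFacts.

(** * Convolution of lamp configurations with cell weights *)

Section Convolution.
Implicit Types (w : int -> int) (u v : lamplighter).

(** The factor 2 appears because the square of the unit translation moves two cells. *)
Definition conv w (f : {fsfun int -> int with 0}) (k : int) : int :=
  \sum_(j <- finsupp f) f j * w (k - 2 * j).

Lemma conv_widen w (f : {fsfun int -> int with 0}) (s : {fset int}) k :
  (finsupp f `<=` s)%fset -> conv w f k = \sum_(j <- s) f j * w (k - 2 * j).
Proof.
move=> fs; apply: big_fset_incl => // j _ jf.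
by rewrite fsfun_dflt // mul0r.
Qed.

Lemma conv_mul w u v k :
  conv w (u * v)%g.2 k = conv w u.2 k + conv w v.2 (k - 2 * u.1).
Proof.
(* A common index set, containing the supports of [u], of the product and of the shifted [v], so
   that the three sums compare term by term. *)
pose s : {fset int} := (finsupp u.2 `|` finsupp (u * v)%g.2 `|`
  [fset (j + u.1)%R | j in finsupp v.2])%fset.
have su : (finsupp u.2 `<=` s)%fset by rewrite /s -fsetUA fsubsetUl.
have suv : (finsupp (u * v)%g.2 `<=` s)%fset.
  by rewrite /s (fsetUC (finsupp _)) -fsetUA fsubsetUl.
have sv : (finsupp v.2 `<=` [fset (j - u.1)%R | j in s])%fset.
  apply/fsubsetP => j jv; apply/imfsetP; exists (j + u.1); last by rewrite addrK.
  by rewrite !in_fsetU; apply/orP; right; apply/imfsetP; exists j.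
clearbody s.
rewrite (conv_widen _ _ su) (conv_widen _ _ suv) (conv_widen _ _ sv).
rewrite big_imfset /=; last by move=> i j _ _; exact: addIr.
rewrite -big_split /=; apply: eq_bigr => j _; rewrite lamp_mulE mulrDl.
by congr (_ + _ * w _); ring.
Qed.

End Convolution.

(** * The square roots attached to sets of naturals *)

Section SquareRoots.
Variable R : realType.
Implicit Types (S : set nat) (k m n : int).

(* Using one-parameter groups makes everything commute on cells of equal parity,
   while translations (even cells) and dilations (odd cells) do not commute. *)
Definition local_map k m : homeo_plus R :=
  if (2 %| k)%Z then translation m%:~R else dilation R m.

Lemma local_mapM k m n : (local_map k m * local_map k n)%g = local_map k (m + n).
Proof. by rewrite /local_map; case: ifP; rewrite ?translationM ?dilationM ?intrD. Qed.

Lemma local_map0 k : local_map k 0 = 1%g.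
Proof. by rewrite /local_map; case: ifP; rewrite ?translation0 ?dilation0. Qed.

Lemma local_map_shift k n : local_map (k - 2 * n) = local_map k.
Proof. by rewrite /local_map (_ : (2 %| k - 2 * n)%Z = (2 %| k)%Z) //; lia. Qed.

Lemma local_map_even_inj n : injective (local_map (2 * n)).
Proof.
move=> i j; rewrite /local_map (_ : (2 %| 2 * n)%Z); last by lia.
by move/translation_inj/intr_inj.
Qed.

(** Indicator function of 0 together with all 2n+1 for n in [S]. *)
Definition weight S k : int :=
  match k with
  | Posz n => if odd n then (`[< S n./2 >] : nat) else (n == 0%N)
  | Negz _ => 0
  end.

Lemma weight_lt0 S k : k < 0 -> weight S k = 0.
Proof. by case: k. Qed.

Lemma weight_even S n : weight S (2 * n) = (n == 0).
Proof.
case: n => n; last by rewrite weight_lt0; lia.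
have -> : 2 * n%:Z = (2 * n)%N by [].
by rewrite /weight oddM /=; congr (nat_of_bool _)%:Z; lia.
Qed.

Lemma weight_odd S (n : nat) : weight S (2 * n + 1)%N = `[< S n >].
Proof. by rewrite /weight /= oddD oddM /= addn1 mul2n /= uphalf_double. Qed.

Definition root_base S := cells (fun k => local_map k (weight S k)).

Definition root_gens S (i : 'I_2) : homeo_plus R :=
  if i == 0 then root_base S else translation (1 : R).

Definition root_group S := generated_subgroup (range (root_gens S)).

(** Put m = 2n+1. As m is odd, on each cell one of the map and its conjugate acts by a translation,
    the other by a dilation. Both can be nontrivial in cell m only, and they are so exactly when n
    lies in [S]. *)
Lemma root_base_commute S (n : nat) :
  commutes_with_conj (2 * n + 1) (root_base S) (translation (1 : R)) <-> ~ S n.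
Proof.
pose m : nat := (2 * n + 1)%N; pose a k := local_map k (weight S k).
have conjE : (translation (1 : R) ^+ m * root_base S * (translation 1 ^+ m)^-1)%g
    = cells (fun k => a (k - m%:Z)).
  by rewrite translationX (translation_cells m%:Z) mulgK.
rewrite /commutes_with_conj -/m conjE /root_base /commute !cellsM.
have aE k : a (k - m%:Z) = if (2 %| k)%Z then dilation R (weight S (k - m%:Z))
    else translation (weight S (k - m%:Z))%:~R.
  have par : (2 %| k - m%:Z)%Z = ~~ (2 %| k)%Z by rewrite /m; lia.
  by rewrite /a /local_map par if_neg.
(* If n lies in [S], commutation in cell [m] would make the unit translation and dilation
   commute. *)
split=> [/cells_inj /(_ m%:Z) + Sn|nSn].
  rewrite aE /a /local_map (_ : (2 %| m%:Z)%Z = false); last by lia.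
  rewrite subrr (weight_even S 0) weight_odd (asboolT Sn) => /esym.
  exact: translation_dilation_neq.
congr cells; apply/funext => k; rewrite aE /local_map; case: ifPn => k2.
  (* Among even cells only cell 0 has a weight, and there the conjugate has the weight of the
     negative cell -m, which is 0. *)
  have [-> | k0] := eqVneq k 0.
    by rewrite [weight S (0 - _)]weight_lt0 ?dilation0 ?mulg1 ?mul1g //; lia.
  have [j kj] : exists j, k = 2 * j by exists (k %/ 2)%Z; lia.
  have -> : weight S k = 0 by rewrite kj weight_even; lia.
  by rewrite translation0 mulg1 mul1g.
have [-> | km] := eqVneq k m%:Z.
  by rewrite weight_odd (asboolF nSn) dilation0 mulg1 mul1g.
have [j kj] : exists j, k - m%:Z = 2 * j by exists ((k - m%:Z) %/ 2)%Z; lia.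
have -> : weight S (k - m%:Z) = 0 by rewrite kj weight_even; lia.
by rewrite translation0 mulg1 mul1g.
Qed.

(** On even cells the weight is the delta at 0, a unit for convolution. *)
Lemma conv_even S f n : conv (weight S) f (2 * n) = f n.
Proof.
rewrite (@conv_widen _ _ (n |` finsupp f)%fset) ?fsubsetU1 //.
rewrite (big_fsetD1 n) ?fset1U1 //= subrr (weight_even S 0) mulr1.
rewrite big_seq_cond big1 ?addr0 // => j /andP[+ _].
rewrite in_fsetD1 => /andP[jn _].
by rewrite -mulrBr weight_even subr_eq0 eq_sym (negPf jn) mulr0.
Qed.

(* Conjugation by the 2j-th power of the unit translation moves cell k-2j to
   cell k, so the exponent contributed at cell k by a lamp configuration is a
   convolution with the weights. *)
Definition root_hom S (u : lamplighter) : homeo_plus R :=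
  (cells (fun k => local_map k (2 * conv (weight S) u.2 k)) *
   translation (2 * u.1)%:~R)%g.

(** Moving the translation past the cells shifts them by an even amount, which keeps the parity and
    hence the one-parameter group; exponents then add by [conv_mul]. *)
Lemma root_homM S : {morph root_hom S : u v / (u * v)%g}.
Proof.
move=> u v; rewrite /root_hom -mulgA [(translation _ * (_ * _))%g]mulgA translation_cells.
rewrite !mulgA cellsM -mulgA translationM; congr (cells _ * translation _)%g.
  apply/funext => k; rewrite local_map_shift local_mapM -mulrDr.
  by rewrite conv_mul.
by rewrite -intrD -mulrDr.
Qed.

(** Lamp [i] is read off from the exponent in cell 2i. *)
Lemma root_hom_inj S : injective (root_hom S).
Proof.
move=> u v /cells_translation_inj[uv1 uv2]; apply: lampP => [|i]; first by lia.
have := uv2 (2 * i); move/local_map_even_inj; rewrite !conv_even; lia.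
Qed.

Lemma root_hom_gens S i : root_hom S (lamp_gens i) = (root_gens S i ^+ 2)%g.
Proof.
rewrite /lamp_gens /root_gens; case: ifP => _.
  rewrite /root_hom mulr0 translation0 mulg1 expgS expg1 cellsM; congr cells.
  apply/funext => k; rewrite local_mapM; congr (local_map k _).
  rewrite (@conv_widen _ _ [fset 0]%fset).
    by rewrite big_seq_fset1 fsfunE in_fset1 eqxx mul1r mulr0 subr0; lia.
  by apply/fsubsetP => j; rewrite mem_finsupp fsfunE; case: ifP; rewrite ?eqxx.
rewrite /root_hom /= translationX (_ : cells _ = 1%g) ?mul1g ?mulr1 //.
apply: homeo_plus_line_eq => y; rewrite cellsE -[in RHS](cell_map1 y).
congr (line_point (cell_map _ y)); apply/funext => k.
by rewrite -[RHS](local_map0 k) /conv big1 ?mulr0 // => j _; rewrite fsfunE mul0r.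
Qed.

Lemma root_group_marked S : marked_square_root lamp_gens (root_group S).
Proof.
exists (root_gens S); split=> //; exists (root_hom S); split=> [|i]; last first.
  exact: root_hom_gens.
(* The squares are images of generators of the lamplighter group, so they generate the whole range
   of [root_hom S]. *)
have -> : range (fun i => (root_gens S i ^+ 2)%g) = root_hom S @` range lamp_gens.
  apply/seteqP; split=> [_ [i _ <-]|_ [_ [i _ <-] <-]].
    by rewrite -root_hom_gens; exists (lamp_gens i) => //; exists i.
  by exists i; rewrite // root_hom_gens.
rewrite -(range_hom_generated (@root_homM S) lamp_gens_generate).
exact: injective_hom_iso (@root_homM S) (@root_hom_inj S).
Qed.

Lemma root_group_iso_countable S :
  countable [set S' | isomorphic_subgroups (root_group S') (root_group S)].
Proof.
have /countable_injP[c cI] : countable (root_group S `*` root_group S).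
  by apply: countableX; exact: countable_generated_subgroup.
have phiP S' : exists phi, isomorphic_subgroups (root_group S') (root_group S) ->
    group_iso_on (root_group S') (root_group S) phi.
  have [[phi ?]|noiso] := pselect (isomorphic_subgroups (root_group S') (root_group S)).
    by exists phi.
  (* A dummy value, making the choice of [phi] total in S'. *)
  by exists id => /noiso.
have [phi {}phiP] := choice phiP.
have Gbase S' : root_group S' (root_base S').
  by apply: sub_generated_subgroup; exists ord0.
have Gtranslation S' : root_group S' (translation (1 : R)).
  by apply: sub_generated_subgroup; exists (lift ord0 ord0).
apply/countable_injP.
(* S' is coded by the images of its two generators under the chosen isomorphism. *)
exists (fun S' => c (phi S' (root_base S'), phi S' (translation (1 : R)))).
move=> S1 S2 /set_mem /phiP iso1 /set_mem /phiP iso2 e.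
have mem_pair S' : group_iso_on (root_group S') (root_group S) (phi S') ->
    (phi S' (root_base S'), phi S' (translation (1 : R))) \in root_group S `*` root_group S.
  by case=> [[fG _ _] _]; apply/mem_set; split; apply: fG.
have [e1 e2] := cI _ _ (mem_pair _ iso1) (mem_pair _ iso2) e.
(* The pair of images alone decides which [n] belong to S'. *)
have rel S' (n : nat) : group_iso_on (root_group S') (root_group S) (phi S') ->
    commutes_with_conj (2 * n + 1) (phi S' (root_base S')) (phi S' (translation 1)) <->
    ~ S' n.
  move=> iso; apply: iff_trans _ (root_base_commute S' n).
  apply: (iso_commutes_with_conj _ _ iso (Gbase S') (Gtranslation S')).
  exact: generated_subgroup_closed.
apply: funext => n; apply: propext; apply/iff_not2.
by have := rel S2 n iso2; rewrite -e1 -e2 => <-; apply: iff_sym; exact: rel.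
Qed.

End SquareRoots.

(** * Counting isomorphism types *)

Lemma uncountable_powerset_nat : ~ countable [set: set nat].
Proof.
(* [D] is Cantor's diagonal set for the coding [c]. *)
case/countable_injP => c cI; pose D := [set n | forall S, c S = n -> ~ S n].
have nD : ~ D (c D) by move=> /[dup] DD /(_ D erefl); exact.
by apply: (nD) => S /(cI _ _ (in_setT _) (in_setT _)) ->.
Qed.

Theorem theorem1p14 (R : realType) :
  ~ countable [set isomorphism_type G |
      G in [set G : set (homeo_plus R) | marked_square_root lamp_gens G]].
Proof.
set types := (X in countable X) => ctypes; apply: uncountable_powerset_nat.
(* With countably many types, the power set of the naturals would be a countable union of these
   fibres, each of them countable. *)
pose fiber t := [set S | isomorphism_type (@root_group R S) = t].
have cover : [set: set nat] `<=` \bigcup_(t in types) fiber t.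
  move=> S _; exists (isomorphism_type (@root_group R S)) => //.
  by exists (@root_group R S) => //; exact: root_group_marked.
apply: sub_countable (subset_card_le cover) _; apply: bigcup_countable => // t _.
have [-> | /set0P[S0 S0t]] := eqVneq (fiber t) set0; first exact: countable0.
apply: sub_countable (@root_group_iso_countable R S0).
apply: subset_card_le => S St; rewrite /=.
(* By reflexivity the group of [S0] lies in its own type, which is also the type of the group of
   [S]. *)
have : isomorphism_type (@root_group R S0) (@root_group R S0).
  by exists id; split=> //; split=> // x Gx; exists x.
by rewrite S0t -St.
Qed.
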